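(* Let $F$ be an $\epsilon$-soft $\mathrm{UPE}(D{:}R|Z;E,\mathcal{H})$, let $\mu\in\mathcal{H}$, let $p\ge 1/|\mathrm{Rng}(D)|$, and let $\kappa=\mathbb{P}_\mu(F(RZ)\le p)$, with $\kappa>0$. Then $$P^{\epsilon/\kappa}_{\max,\,\mu[DZE|F\le p]}(D|ZE)\;\le\; p/\kappa .$$
   Context: All random variables (RVs) have finite value spaces; $\mathrm{Rng}(X)$ is the value space of $X$. Juxtaposition denotes joint RVs and joint values. $R,Z,E$ are RVs, and $D$ is an RV determined by $R$ (i.e. $D$ is a function of $R$). $\mathcal{H}$ is a set (a model) of joint distributions of $R,Z,E$. $\mu[X|\phi]$ denotes the distribution of $X$ conditional on the event $\phi$; conditions involving conditional probabilities are only required for conditioning values of positive probability. $\mathrm{TV}$ is total variation distance, $\mathrm{TV}(\nu,\nu')=\frac12\sum_x|\nu(x)-\nu'(x)|$. A subprobability distribution is a non-negative function $\tilde\nu$ with weight $w(\tilde\nu)=\sum_x\tilde\nu(x)\le 1$. Soft UPE: for $0\le\epsilon\le1$, a function $F:\mathrm{Rng}(RZ)\to[0,\infty)$ is an $\epsilon$-soft $\mathrm{UPE}(D{:}R|Z;E,\mathcal{H})$ (level-$\epsilon$ $E$-uniform soft probability estimator) if for all values $e$ of $E$ and all $\mu\in\mathcal{H}$: (1) there exist subprobability distributions $\tilde\mu_z\le\mu[DR|ze]$ of $DR$ with $\sum_z w(\tilde\mu_z)\mu(z|e)\ge 1-\epsilon$; (2) there exists a non-negative function $q(r|dz)$ with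 $\sum_r q(r|dz)=1$ for all $dz$, such that $\tilde\mu_z(dr)\le F(rz)\,q(r|dz)$ for all $d,r,z$. ($\tilde\mu_z$ and $q$ may depend on $e$ and $\mu$.) Smooth average conditional max-prob: for a distribution $\mu'$ of $DZE$ and $\epsilon'\ge0$, $P^{\epsilon'}_{\max,\mu'}(D|ZE)$ is the minimum $p'$ such that there exists a distribution $\nu$ of $DZE$ with $\mathrm{TV}(\nu,\mu')\le\epsilon'$ and $\sum_{ze}\max_d(\nu(d|ze))\,\nu(ze)\le p'$. *)

(* Defs.v *)
From mathcomp Require Import all_boot all_order all_algebra.
From mathcomp Require Import all_classical all_reals all_analysis.
Set Implicit Arguments.
Unset Strict Implicit.
Unset Printing Implicit Defensive.
Import Order.TTheory GRing.Theory Num.Theory numFieldNormedType.Exports.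
Local Open Scope classical_set_scope.
Local Open Scope ring_scope.

Section FiniteDistributions.
Context {K : realType} {T U : finType}.
Implicit Types (mu nu : T -> K) (phi : pred T).

Definition weight nu : K := \sum_x nu x.

Definition subdistr : set (T -> K) :=
  [set nu | (forall x, 0 <= nu x) /\ weight nu <= 1].

Definition distr : set (T -> K) :=
  [set mu | (forall x, 0 <= mu x) /\ weight mu = 1].

Definition prob mu phi : K := \sum_(x | phi x) mu x.

(* The distribution mu[X | phi] of the random variable X on the outcome space
   T, conditional on the event phi; it is meaningful when 0 < prob mu phi, and
   is identically 0 when prob mu phi = 0, since x / 0 = 0. *)
Definition cond_distr mu (X : T -> U) phi : U -> K :=
  fun u => prob mu [pred x | (X x == u) && phi x] / prob mu phi.

Definition total_variation mu nu : K := 2^-1 * \sum_x `|mu x - nu x|.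

End FiniteDistributions.

Section SoftUPE.
Context {K : realType} {tR tZ tE tD : finType}.

(* Outcomes are triples (r, z, e) of values of R, Z, E; the variable D, being
   determined by R, is given by a function Dof of the value of R. The value
   q (d, z) r stands for q(r|dz). *)
Definition soft_upe (Dof : tR -> tD) (H : set (tR * tZ * tE -> K)) (eps : K)
    (F : tR * tZ -> K) : Prop :=
  (forall rz, 0 <= F rz) /\
  forall (e : tE) (mu : tR * tZ * tE -> K), H mu ->
    0 < prob mu (fun w => w.2 == e) ->
    exists mut : tZ -> tD * tR -> K,
      [/\ forall z, subdistr (mut z),
          forall z, 0 < prob mu (fun w => (w.1.2, w.2) == (z, e)) ->
            forall dr, mut z dr <=
              cond_distr mu (fun w => (Dof w.1.1, w.1.1))
                (fun w => (w.1.2, w.2) == (z, e)) dr,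
          1 - eps <= \sum_z weight (mut z) *
            cond_distr mu (fun w => w.1.2) (fun w => w.2 == e) z
        & exists q : tD * tZ -> tR -> K,
            [/\ forall dz r, 0 <= q dz r,
                forall dz, \sum_r q dz r = 1
              & forall d r z, mut z (d, r) <= F (r, z) * q (d, z) r]].

End SoftUPE.

Section SmoothMaxProb.
Context {K : realType} {tD tZ tE : finType}.
Implicit Types nu mu : tD * tZ * tE -> K.

(* The base value 0 of the maximum does not affect it, conditional probabilities
   being non-negative; values ze with prob nu (ZE = ze) = 0 contribute 0. *)
Definition avg_cond_maxprob nu : K :=
  \sum_(ze : tZ * tE)
    (\big[Num.max/0]_(d : tD)
       cond_distr nu (fun w => w.1.1) (fun w => (w.1.2, w.2) == ze) d)
    * prob nu (fun w => (w.1.2, w.2) == ze).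

Definition smooth_maxprob_bounds (eps : K) mu : set K :=
  [set p' | exists nu, [/\ distr nu, total_variation nu mu <= eps
                         & avg_cond_maxprob nu <= p']].

(* P^eps_{max,mu}(D|ZE). The infimum is a minimum: see smooth_maxprob_min. *)
Definition smooth_maxprob (eps : K) mu : K :=
  inf (smooth_maxprob_bounds eps mu).

End SmoothMaxProb.

Section MinimumAttained.
Context {K : realType}.

Lemma prob_ge0 (T : finType) (mu : T -> K) phi :
  (forall x, 0 <= mu x) -> 0 <= prob mu phi.
Proof. by move=> mu0; apply: sumr_ge0. Qed.

Lemma cond_distr_distr (T U : finType) (mu : T -> K) (X : T -> U) phi :
  distr mu -> 0 < prob mu phi -> distr (cond_distr mu X phi).
Proof.
move=> [mu0 _] phi0; split=> [u|]; first by rewrite divr_ge0 ?prob_ge0.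
rewrite /weight /cond_distr -mulr_suml /prob.
have -> : \sum_u \sum_(x | [pred x | (X x == u) && phi x] x) mu x =
    \sum_(x | phi x) mu x.
  rewrite [RHS](partition_big X predT) //=; apply: eq_bigr => u _.
  by apply: eq_bigl => x; rewrite /= andbC.
by rewrite divff // gt_eqF.
Qed.

Variables tD tZ tE : finType.
Implicit Types nu mu : tD * tZ * tE -> K.

Lemma avg_cond_maxprobE nu : (forall w, 0 <= nu w) ->
  avg_cond_maxprob nu =
  \sum_(ze : tZ * tE) \big[Num.max/0]_(d : tD) nu (d, ze.1, ze.2).
Proof.
move=> nu0; apply: eq_bigr => -[z e] _ /=.
set P := prob nu _.
have P0 : 0 <= P by exact: prob_ge0.
have jointE d : prob nu [pred x | (x.1.1 == d) && ((x.1.2, x.2) == (z, e))]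
    = nu (d, z, e).
  rewrite /prob (big_pred1 (d, z, e)) // => -[[d' z'] e'] /=.
  by rewrite -!pair_eqE /= /pair_eq /= andbA.
rewrite (big_morph (fun x => x * P) (id1 := 0) (op1 := Num.max)); last first.
- by rewrite mul0r.
- by move=> x y /=; rewrite maxr_pMl.
apply: eq_bigr => d _; rewrite /cond_distr jointE -/P.
have [P_eq0|Pn0] := eqVneq P 0; last by rewrite divfK.
rewrite P_eq0 mulr0; apply/esym/eqP; rewrite eq_le nu0 andbT -P_eq0 /P /prob.
by rewrite (bigD1 (d, z, e)) //= lerDl sumr_ge0.
Qed.

Lemma smooth_maxprob_min (eps : K) mu : distr mu -> 0 <= eps ->
  smooth_maxprob_bounds eps mu (smooth_maxprob eps mu) /\
  lbound (smooth_maxprob_bounds eps mu) (smooth_maxprob eps mu).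
Proof.
move=> muD eps0; pose I : finType := (tD * tZ * tE)%type.
pose X := prod_topology (fun _ : I => K).
pose A : set X := [set nu : X | distr nu /\ total_variation nu mu <= eps].
have cev (i : I) : continuous (fun f : X => f i).
  by move=> f; exact: (@proj_continuous I (fun=> K) i f).
have csum (J : finType) (G : J -> X -> K) :
    (forall j, continuous (G j)) -> continuous (fun f => \sum_j G j f).
  by move=> cG; apply: continuous_big => [|j _]; [exact: add_continuous|].
have cmax (J : finType) (G : J -> X -> K) : (forall j, continuous (G j)) ->
    continuous (fun f => \big[Num.max/0]_j G j f).
  move=> cG; apply: continuous_big => [|j _]; last exact: cG.
  by case=> x y; apply: (@continuous_max K (K * K)%type fst snd (x, y));
    [exact: cvg_fst|exact: cvg_snd].
have A0 : A !=set0.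
  exists mu; split=> //; rewrite /total_variation big1 ?mulr0// => w _.
  by rewrite subrr normr0.
have clA : closed A.
  have -> : A = (\bigcap_(i in @setT I) (fun f : X => f i) @^-1` [set x | 0 <= x])
      `&` ((fun f : X => \sum_i f i) @^-1` [set 1])
      `&` ((fun f : X => 2^-1 * \sum_i `|f i - mu i|)
            @^-1` [set x | x <= eps]).
    apply/seteqP; split=> [f [[f0 f1] tv]|f [[f0 f1] tv]].
      by split; [split; [move=> i _; exact: f0|exact: f1]|exact: tv].
    by split; [split; [move=> i; exact: f0|exact: f1]|exact: tv].
  have pre (f : X -> K) B : continuous f -> closed B -> closed (f @^-1` B).
    by move=> /continuous_closedP; apply.
  apply: closedI; first apply: closedI.
  - by apply: closed_bigI => i _; apply: pre; [exact: cev|exact: closed_ge].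
  - by apply: pre; [exact: csum|exact: closed_eq].
  - apply: pre; last exact: closed_le.
    have ctv i : continuous (fun f : X => `|f i - mu i|).
      move=> f; apply: (@continuous_comp X K K (fun f : X => f i)
        (fun x => `|x - mu i|)); first exact: cev.
      apply: cvg_norm; apply: cvgB; [exact: cvg_id|exact: cvg_cst].
    move=> f; apply: (@continuous_comp X K K
      (fun f : X => \sum_i `|f i - mu i|) ( *%R 2^-1)).
      exact: (csum _ _ ctv).
    exact: mulrl_continuous.
have cA : compact A.
  have cube := @tychonoff I (fun=> K) (fun=> `[0, 1]%classic)
    (fun=> @segment_compact K 0 1).
  apply: (subclosed_compact clA cube) => f [[f0 f1] _] i /=.
  rewrite in_itv /= f0 /= -f1 /weight (bigD1 i) //= lerDl sumr_ge0 //.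
pose g (f : X) := \sum_(ze : tZ * tE) \big[Num.max/0]_(d : tD) f (d, ze.1, ze.2).
have cg : {within A, continuous g}.
  apply: continuous_subspaceT; apply: csum => ze; apply: cmax => d; exact: cev.
have [nu /set_mem[nuD nuTV] numin] := compact_EVT_min A0 cA cg.
have Sg : smooth_maxprob_bounds eps mu (g nu).
  by exists nu; split=> //; rewrite avg_cond_maxprobE //; case: nuD.
have lbg : lbound (smooth_maxprob_bounds eps mu) (g nu).
  move=> p' [nu' [nu'D tv]]; apply: le_trans.
  rewrite avg_cond_maxprobE; last by case: nu'D.
  by apply: numin; apply/mem_set.
have -> : smooth_maxprob eps mu = g nu; last by [].
apply/eqP; rewrite eq_le; apply/andP; split.
  by apply: ge_inf => //; exists (g nu).
by apply: lb_le_inf => //; exists (g nu).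
Qed.

End MinimumAttained.

(* Main.v *)
(* Weighting the soft estimator's subdistributions by mu(ze) and restricting to
   F <= p gives a function s <= mu(dze, F <= p) that misses at most eps of the
   mass and satisfies s <= p mu(ze), because sum_r q(r|dz) = 1. Since
   p |Rng(D)| >= 1, there is room below the cap (p / kappa) mu(ze) to complete
   s / kappa to a distribution nu. Both nu and mu[DZE | F <= p] dominate
   s / kappa, so they are within eps / kappa, and the cap bounds
   sum_ze max_d nu(dze) by p / kappa. *)
Require Import Defs.
From mathcomp Require Import all_boot all_order all_algebra.
From mathcomp Require Import all_classical all_reals all_analysis.
From mathcomp Require Import lra.
Import Order.TTheory GRing.Theory Num.Theory numFieldNormedType.Exports.
Local Open Scope classical_set_scope.
Local Open Scope ring_scope.

Lemma ler_weight {K : realType} {T : finType} (a b : T -> K) :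
  (forall x, a x <= b x) -> weight a <= weight b.
Proof. by move=> ab; apply: ler_sum. Qed.

(** Weight is affine along the segment from [a] to [c], so it equals 1 at some point of the segment,
    and every point of the segment lies between its ends. *)
Lemma distr_between {K : realType} {T : finType} (a c : T -> K) :
  (forall x, 0 <= a x) -> (forall x, a x <= c x) ->
  weight a <= 1 -> 1 <= weight c ->
  exists2 nu, distr nu & forall x, a x <= nu x <= c x.
Proof.
move=> a0 ac wa wc; pose t := (1 - weight a) / (weight c - weight a).
have t0 : 0 <= t by apply: divr_ge0; lra.
have t1 : t <= 1.
  (* If the two weights agree, both are 1, and [t] is 0 by the convention x / 0 = 0. *)
  have [wE|wN] := eqVneq (weight c - weight a) 0.
    by rewrite /t wE invr0 mulr0.
  have w0 : 0 < weight c - weight a by rewrite lt_neqAle eq_sym wN; lra.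
  by rewrite ler_pdivrMr // mul1r; lra.
have bnd x : a x <= a x + t * (c x - a x) <= c x.
  have := ac x => acx; apply/andP; split.
    by rewrite lerDl mulr_ge0 // subr_ge0.
  by rewrite -lerBrDl ler_piMl // subr_ge0.
exists (fun x => a x + t * (c x - a x)) => //; split=> [x|].
  by case/andP: (bnd x) => + _; exact: le_trans.
rewrite /weight big_split /= -mulr_sumr sumrB -/(weight a) -/(weight c).
have [wE|wN] := eqVneq (weight c - weight a) 0; last by rewrite divfK //; lra.
by rewrite wE mulr0; lra.
Qed.

(** Pointwise |mu - nu| <= (mu - a) + (nu - a), and the right side sums to 2 (1 - weight a); the
    factor 1/2 of the distance cancels the 2. *)
Lemma total_variation_le_weight {K : realType} {T : finType}
    (mu nu a : T -> K) :
  distr mu -> distr nu -> (forall x, a x <= mu x) -> (forall x, a x <= nu x) ->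
  Defs.total_variation mu nu <= 1 - weight a.
Proof.
move=> [_ wmu] [_ wnu] amu anu; rewrite /Defs.total_variation.
have : \sum_x `|mu x - nu x| <= \sum_x ((mu x - a x) + (nu x - a x)).
  apply: ler_sum => x _; have := amu x; have := anu x.
  by rewrite ler_norml => *; apply/andP; split; lra.
rewrite big_split /= !sumrB -/(weight mu) -/(weight nu) -/(weight a) wmu wnu.
lra.
Qed.

Section JointProbabilities.
Context {K : realType} {tR tZ tE tD : finType}.
Variables (Dof : tR -> tD) (mu : tR * tZ * tE -> K).

Lemma prob_ZE z e :
  prob mu (fun w => (w.1.2, w.2) == (z, e)) = \sum_r mu (r, z, e).
Proof.
rewrite /prob (reindex_onto (fun r => (r, z, e)) (fun w => w.1.1)) /=.
  by apply: eq_bigl => r; rewrite !eqxx.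
by case=> -[r z'] e' /= /eqP[-> ->].
Qed.

Lemma prob_E e : prob mu (fun w => w.2 == e) = \sum_z \sum_r mu (r, z, e).
Proof.
rewrite /prob (partition_big (fun w => w.1.2) predT) //=.
apply: eq_bigr => z _; rewrite -prob_ZE; apply: eq_bigl => w.
by rewrite xpair_eqE andbC.
Qed.

Lemma prob_DZE_cond (phi : pred (tR * tZ)) d z e :
  prob mu [pred w | ((Dof w.1.1, w.1.2, w.2) == (d, z, e)) && phi w.1] =
  \sum_(r | phi (r, z)) (if Dof r == d then mu (r, z, e) else 0).
Proof.
rewrite /prob (reindex_onto (fun r => (r, z, e)) (fun w => w.1.1)) /=.
  rewrite -big_mkcondr; apply: eq_bigl => r.
  by rewrite !xpair_eqE !eqxx !andbT andbC.
by case=> -[r z'] e' /= /andP[/eqP[_ -> ->]].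
Qed.

Lemma prob_DRZE d r z e :
  prob mu [pred w | ((Dof w.1.1, w.1.1) == (d, r)) &&
                    ((w.1.2, w.2) == (z, e))] =
  if Dof r == d then mu (r, z, e) else 0.
Proof.
rewrite /prob; case: ifP => [/eqP Dr|Dr].
  rewrite (big_pred1 (r, z, e)) // => -[[r' z'] e'] /=.
  rewrite !xpair_eqE; have [->|] := eqVneq r' r; last by rewrite andbF.
  by rewrite Dr eqxx.
rewrite big_pred0 // => -[[r' z'] e'] /=.
by rewrite !xpair_eqE; have [->|] := eqVneq r' r; rewrite ?Dr ?andbF.
Qed.

(** The slice at a fixed [e] of the function s described above, with the missed mass bounded by eps
    mu(e), so that summing over [e] gives eps. *)
Lemma soft_upe_capped (H : set (tR * tZ * tE -> K)) (eps p : K)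
    (F : tR * tZ -> K) (e : tE) :
  (forall w, 0 <= mu w) -> 0 <= eps -> 0 <= p ->
  soft_upe Dof H eps F -> H mu ->
  let b d z := prob mu
    [pred w | ((Dof w.1.1, w.1.2, w.2) == (d, z, e)) && (F w.1 <= p)] in
  exists s : tD -> tZ -> K,
    [/\ forall d z, 0 <= s d z <= b d z,
        forall d z, s d z <= p * \sum_r mu (r, z, e)
      & \sum_d \sum_z (b d z - s d z) <= eps * \sum_z \sum_r mu (r, z, e)].
Proof.
move=> mu0 eps0 p0 [_ F_upe] Hmu b.
pose P z := \sum_r mu (r, z, e).
pose g d z r := if Dof r == d then mu (r, z, e) else 0.
have P0 z : 0 <= P z by exact: sumr_ge0.
have g0 d z r : 0 <= g d z r by rewrite /g; case: ifP.
have bE d z : b d z = \sum_(r | F (r, z) <= p) g d z r.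
  exact: (prob_DZE_cond (fun rz => F rz <= p)).
have gE z : \sum_d \sum_r g d z r = P z.
  rewrite exchange_big; apply: eq_bigr => r _.
  by rewrite /g -big_mkcond /= (big_pred1 (Dof r)) // => d; rewrite eq_sym.
have sumP0 : 0 <= \sum_z P z by exact: sumr_ge0.
have : 0 <= prob mu (fun w => w.2 == e) by exact: prob_ge0.
(* If mu(e) = 0, [soft_upe] promises nothing at [e]; but then every mu(ze) vanishes, hence so does
   [b], and s = 0 works. *)
rewrite le_eqVlt => /predU1P[/esym|] Pe.
  have Pz z : P z = 0.
    rewrite /P; move: Pe; rewrite prob_E => /psumr_eq0P -> // z' _.
    exact: P0.
  exists (fun _ _ => 0); split=> [d z|d z|].
  - by rewrite lexx prob_ge0.
  - exact: mulr_ge0 p0 (P0 z).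
  apply: le_trans (mulr_ge0 eps0 sumP0).
  rewrite exchange_big /= big1 // => z _; apply/eqP.
  rewrite eq_le; apply/andP; split; last first.
    by apply: sumr_ge0 => d _; rewrite subr0 prob_ge0.
  rewrite -[leRHS](Pz z) -gE; apply: ler_sum => d _; rewrite subr0 bE.
  by rewrite big_mkcond; apply: ler_sum => r _; case: ifP.
have [mut [mut_sub mut_le mut_w [q [q0 q1 mutF]]]] := F_upe e mu Hmu Pe.
have mut0 z dr : 0 <= mut z dr by case: (mut_sub z) => + _; exact.
(* Here [g d z r] is mu(drze). The bound on [mut z] is available only when mu(ze) > 0; otherwise the
   left side is 0. *)
have Pmut d z r : P z * mut z (d, r) <= g d z r.
  have := P0 z; rewrite le_eqVlt => /predU1P[<-|Pz]; first by rewrite mul0r.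
  have := mut_le z; rewrite prob_ZE => /(_ Pz (d, r)).
  by rewrite /cond_distr prob_DRZE prob_ZE ler_pdivlMr // mulrC.
have mut_cap d z : \sum_(r | F (r, z) <= p) mut z (d, r) <= p.
  rewrite -[leRHS]mulr1 -(q1 (d, z)) mulr_sumr big_mkcond.
  apply: ler_sum => r _; case: ifP => Fp; last exact: mulr_ge0.
  by apply: le_trans (mutF d r z) _; rewrite ler_wpM2r.
exists (fun d z => \sum_(r | F (r, z) <= p) P z * mut z (d, r)).
split=> [d z|d z|].
- apply/andP; split; first by apply: sumr_ge0 => r _; exact: mulr_ge0.
  by rewrite bE; apply: ler_sum.
- by rewrite -mulr_sumr mulrC ler_wpM2r.
have condE z : cond_distr mu (fun w => w.1.2) (fun w => w.2 == e) z =
    P z / prob mu (fun w => w.2 == e).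
  by rewrite /P -prob_ZE.
(* Multiplying the weight condition by mu(e) turns each mu(z|e) into mu(ze). *)
have : (1 - eps) * \sum_z P z <= \sum_z P z * weight (mut z).
  rewrite -ler_pdivlMr -?prob_E // mulr_suml; apply: le_trans mut_w _.
  by apply: ler_sum => z _; rewrite condE mulrA (mulrC (weight _)).
(* Dropping the r with F(rz) > p can only lower the missed mass, since by [Pmut] each dropped
   difference is non-negative. *)
suff : \sum_d \sum_z (b d z - \sum_(r | F (r, z) <= p) P z * mut z (d, r)) <=
    \sum_z (P z - P z * weight (mut z)).
  by rewrite sumrB -/P; lra.
rewrite exchange_big; apply: ler_sum => z _.
have -> : P z * weight (mut z) = \sum_d \sum_r P z * mut z (d, r).
  by rewrite pair_bigA mulr_sumr; apply: eq_bigr => -[].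
rewrite -[X in X - _]gE -sumrB; apply: ler_sum => d _.
rewrite bE -!sumrB big_mkcond.
by apply: ler_sum => r _; case: ifP => // _; rewrite subr_ge0.
Qed.

End JointProbabilities.

Theorem lemma18 (K : realType) (tR tZ tE tD : finType) (Dof : tR -> tD)
    (H : set (tR * tZ * tE -> K)) (H_distr : H `<=` distr)
    (eps : K) (eps_ge0 : 0 <= eps) (eps_le1 : eps <= 1)
    (F : tR * tZ -> K) (F_upe : soft_upe Dof H eps F)
    (mu : tR * tZ * tE -> K) (mu_in_H : H mu)
    (p : K) (p_ge : 1 / #|tD|%:R <= p)
    (kappa : K) (kappa_def : kappa = prob mu (fun w => F w.1 <= p))
    (kappa_gt0 : 0 < kappa) :
  smooth_maxprob (eps / kappa)
    (cond_distr mu (fun w => (Dof w.1.1, w.1.2, w.2)) (fun w => F w.1 <= p))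
    <= p / kappa.
Proof.
have [mu0 mu1] := H_distr _ mu_in_H.
set b' := cond_distr _ _ _.
have b'D : distr b' by apply: cond_distr_distr => //; rewrite -kappa_def.
have p0 : 0 <= p by apply: le_trans p_ge; rewrite divr_ge0.
pose b e d z := prob mu
  [pred w | ((Dof w.1.1, w.1.2, w.2) == (d, z, e)) && (F w.1 <= p)].
have b'E d z e : b' (d, z, e) = b e d z / kappa by rewrite kappa_def.
pose P z e := \sum_r mu (r, z, e).
have P0 z e : 0 <= P z e by exact: sumr_ge0.
have P1 : \sum_e \sum_z P z e = 1.
  rewrite -mu1 /weight [RHS](partition_big (fun w => w.2) predT) //=.
  by apply: eq_bigr => e _; rewrite -prob_E.
(* The estimator's subdistributions depend on [e], so one slice is chosen for each [e]. *)
have /choice[s sP] := fun e =>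
  soft_upe_capped Dof mu H eps p F e mu0 eps_ge0 p0 F_upe mu_in_H.
(* [a] is the floor s / kappa and [c] the cap, constant in d, between which nu is sought. *)
pose a (w : tD * tZ * tE) := s w.2 w.1.1 w.1.2 / kappa.
pose c (w : tD * tZ * tE) := p / kappa * P w.1.2 w.2.
have sumE (h : tE -> tD -> tZ -> K) :
    \sum_(w : tD * tZ * tE) h w.2 w.1.1 w.1.2 = \sum_e \sum_d \sum_z h e d z.
  rewrite -(pair_bigA _ (fun dz e => h e dz.1 dz.2)) exchange_big /=.
  by apply: eq_bigr => e _; rewrite -(pair_bigA _ (h e)).
have a0 w : 0 <= a w.
  rewrite divr_ge0 ?(ltW kappa_gt0) //.
  by case: (sP w.2) => /(_ w.1.1 w.1.2)/andP[].
have ab' w : a w <= b' w.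
  case: w => [[d z] e]; rewrite b'E ler_pM2r ?invr_gt0 //.
  by case: (sP e) => /(_ d z)/andP[].
have ac w : a w <= c w.
  rewrite /c mulrAC ler_pM2r ?invr_gt0 //.
  by case: (sP w.2) => _ /(_ w.1.1 w.1.2).
have wa : weight a <= 1 by case: b'D => _ <-; exact: ler_weight.
have deficit : 1 - weight a <= eps / kappa.
  case: b'D => _ <-; rewrite /weight -sumrB ler_pdivlMr // mulr_suml.
  have -> : \sum_w (b' w - a w) * kappa =
      \sum_(w : tD * tZ * tE) (b w.2 w.1.1 w.1.2 - s w.2 w.1.1 w.1.2).
    apply: eq_bigr => -[[d z] e] _.
    by rewrite b'E -mulrBl divfK // gt_eqF.
  rewrite (sumE (fun e d z => b e d z - s e d z)).
  rewrite -[leRHS]mulr1 -P1 mulr_sumr; apply: ler_sum => e _.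
  by case: (sP e).
have kappa_le1 : kappa <= 1.
  rewrite kappa_def -mu1 /weight [leRHS](bigID (fun w => F w.1 <= p)) /=.
  by rewrite lerDl sumr_ge0.
(* If D had no values, [Dof] would leave R with none, and [mu] could not have weight 1. *)
have D_gt0 : 0 < #|tD|%:R :> K.
  rewrite ltr0n lt0n; apply/eqP => /card0_eq D0.
  have : weight mu = 0.
    by apply: big1 => -[[r z] e] _; have := D0 (Dof r).
  by move/eqP; rewrite mu1 oner_eq0.
(* Summing the cap over d gives a factor |Rng(D)|, so its weight is p |Rng(D)| / kappa >= 1 / kappa
   >= 1. *)
have wc : 1 <= weight c.
  rewrite /weight (sumE (fun e d z => p / kappa * P z e)).
  rewrite exchange_big /= sumr_const.
  under eq_bigr => e _ do rewrite -mulr_sumr.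
  rewrite -mulr_sumr P1 mulr1 -mulr_natr mulrAC ler_pdivlMr // mul1r.
  by apply: le_trans kappa_le1 _; rewrite -ler_pdivrMr.
have [nu nuD nuac] := distr_between a c a0 ac wa wc.
have [_ lb] := smooth_maxprob_min b'D (divr_ge0 eps_ge0 (ltW kappa_gt0)).
apply: lb; exists nu; split=> //.
  apply: le_trans deficit; apply: total_variation_le_weight => // w.
  by case/andP: (nuac w).
rewrite avg_cond_maxprobE; last by case: nuD.
(* Spreading p / kappa over ze in proportion to mu(ze) reduces the bound to the cap at each ze. *)
have -> : p / kappa = \sum_(ze : tZ * tE) p / kappa * P ze.1 ze.2.
  by rewrite -mulr_sumr -(pair_bigA _ P) exchange_big /= P1 mulr1.
apply: ler_sum => -[z e] _; apply/bigmax_leP; split=> [|d _].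
  by rewrite mulr_ge0 ?divr_ge0 ?(ltW kappa_gt0).
by case/andP: (nuac (d, z, e)).
Qed.
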